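(* Let $(X,\|\cdot\|)$ be a normed vector space over $\mathbb{R}$ of dimension $d<\infty$, let $\mu$ be a Radon measure on $X$, let $\Omega$ be a measurable subset of $X$, let $f$ be a nonnegative, real-valued, measurable function on $\Omega$, and let $F\in\mathbb{R}$. Then $\int_\Omega f\,d\mu$ is finite and equals $F$ if the following condition holds for some $\lambda\ge1$ and some $\mu$-a.e., $\lambda$-Morse cover $\mathcal{S}$ of $\Omega$: For all $\varepsilon>0$ there is a gauge function $\delta:\Omega\to(0,1]$ such that for any finite or countably infinite disjoint sequence $\langle S_n(x_n)\rangle$ of $\delta$-fine sets from $\mathcal{S}$ (with tags $x_n$) covering all but a set of $\mu$-measure $0$ of $\Omega$ we have $$\Bigl|\sum_n f(x_n)\,\mu(S_n)-F\Bigr|<\varepsilon.$$ Conversely, if $\int_\Omega f\,d\mu$ is finite and equals $F$, then the condition holds for any $\lambda\ge1$ and any $\mu$-a.e., $\lambda$-Morse cover $\mathcal{S}$ of $\Omega$.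
   Context: $B(a,r)=\{x\in X:\|x-a\|\le r\}$ is the closed ball. Radon measure: a measure $\mu$ on a $\sigma$-algebra $\mathcal{M}$ of subsets of $X$ such that $\mathcal{M}$ contains the Borel sets, compact sets have finite measure, and every $E\in\mathcal{M}$ satisfies $\mu(E)=\sup\{\mu(K):K\subseteq E,\ K\text{ compact}\}=\inf\{\mu(G):G\supseteq E,\ G\text{ open}\}$. ''Measurable'' (or $\mu$-measurable) means measurable with respect to the $\mu$-completion of $\mathcal{M}$. Morse sets: for $\lambda\ge1$ and $a\in X$, a set $S=S_\lambda(a)\subseteq X$ is a $\lambda$-Morse set associated with $a$ if there is $r>0$ such that $B(a,r)\subseteq S\subseteq B(a,\lambda r)$ and $S$ is starlike with respect to $B(a,r)$, i.e. for each $y\in B(a,r)$ and $x\in S$ the segment $\{\alpha y+(1-\alpha)x:0\le\alpha\le1\}$ is contained in $S$. The point $a$ is the tag of $S$. A gauge function is a strictly positive function $\delta$ bounded above by some finite $R$ (defined on $X$, or on the set of tags). $S_\lambda(a)$ is $\delta$-fine if $\lambda r\le\delta(a)$. Morse covers: a $\lambda$-Morse cover of $\Omega$ is a collection $\mathcal{S}$ consisting of at least one $\lambda$-Morse set associated with each point $a\in\Omega$ (the same $\lambda$ for all sets; tags are points of $\Omega$) such that the diameters of the sets in $\mathcal{S}$ have a finite upper bound. It is fine if for each $a\in\Omega$ and arbitrarily small values of $r>0$ there are associated sets $S_\lambda(a)\in\mathcal{S}$ with $B(a,r)\subseteq S_\lambda(a)\subseteq B(a,\lambda r)$ and $S_\lambda(a)$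 starlike with respect to $B(a,r)$. It is a $\mu$-a.e. cover of $\Omega$ if (i) it is fine, (ii) each set in it is $\mu$-measurable, and (iii) for any $\varepsilon>0$ and any strictly positive gauge function $\delta$ there is a finite or infinite sequence of disjoint, $\delta$-fine sets $S_n\in\mathcal{S}$ such that $\mu(\Omega\setminus\bigcup_nS_n)=0$ and $\mu(\bigcup_nS_n\setminus\Omega)<\varepsilon$. *)

(* Defs.v *)
From HB Require Import structures.
From mathcomp Require Import all_boot all_order all_algebra.
From mathcomp Require Import all_classical all_reals all_analysis.

Set Implicit Arguments.
Unset Strict Implicit.
Unset Printing Implicit Defensive.

Import Order.TTheory GRing.Theory Num.Theory.
Import numFieldNormedType.Exports.

Local Open Scope classical_set_scope.
Local Open Scope ring_scope.

(* Finite-dimensional normed spaces. The [vectType] component provides some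
   linear isomorphism with a ['rV_n]; it is unrelated to the norm. *)
#[short(type="normedVectType")]
HB.structure Definition NormedVector (K : numFieldType) :=
  {V of NormedModule K V & Vector K V}.

(* An alias of [T], carrying the completion of the sigma-algebra for [mu]. *)
Definition completion_type d (T : measurableType d) (R : realType)
  (mu : {measure set T -> \bar R}) : Type := T.

Section completion.
Context d (T : measurableType d) (R : realType).
Variable mu : {measure set T -> \bar R}.
Local Open Scope ereal_scope.

Definition completion_decomposition (E A : set T) : Prop :=
  measurable A /\ exists2 N, mu.-negligible N & E = A `|` N.

Definition completion_measurable : set (set T) :=
  [set E | exists A, completion_decomposition E A].

(* [completion (A `|` N) = mu A] for [A] measurable and [N] negligible: see
   [completionE]. *)
Definition completion (E : set (completion_type mu)) : \bar R :=
  mu (xget set0 [set A : set T | completion_decomposition E A]).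

Let decomposition_le (E A B : set T) :
  completion_decomposition E A -> completion_decomposition E B ->
  mu A <= mu B.
Proof.
move=> [mA [N _ EA]] [mB [N' [Z [mZ Z0 NZ]] EB]].
rewrite -(measureU0 mB mZ Z0) le_measure ?inE//; first exact: measurableU.
apply: (@subset_trans _ E); first by rewrite EA; exact: subsetUl.
by rewrite EB; exact: setUS.
Qed.

Lemma completion_decompositionE (E A : set T) :
  completion_decomposition E A -> completion E = mu A.
Proof.
move=> EA; apply/eqP; rewrite eq_le; rewrite /completion; case: xgetP.
- by move=> B _ EB; rewrite !(@decomposition_le E).
- by move=> /(_ A).
Qed.

Lemma completionE (A N : set T) : measurable A -> mu.-negligible N ->
  completion (A `|` N) = mu A.
Proof.
by move=> mA N0; apply: completion_decompositionE; split => //; exists N.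
Qed.

Lemma sub_completion_measurable : measurable `<=` completion_measurable.
Proof.
move=> A mA; exists A; split => //; exists set0; last by rewrite setU0.
exact: negligible_set0.
Qed.

Let completion_measurable0 : completion_measurable set0.
Proof. exact: sub_completion_measurable. Qed.

Let completion_measurableC E :
  completion_measurable E -> completion_measurable (~` E).
Proof.
move=> [A [mA [N [Z [mZ Z0 NZ]] ->]]]; exists (~` (A `|` Z)); split.
  by apply: measurableC; exact: measurableU.
exists (~` (A `|` N) `&` Z); first by exists Z; split => // x [].
rewrite predeqE => x; split=> [AN|[AZ|[]//]].
- have [Zx|Zx] := pselect (Z x); [by right|left].
  by move=> [Ax|//]; apply: AN; left.
- by move=> [Ax|/NZ Zx]; apply: AZ; [left|right].
Qed.

Let decomposition_bigcup (E A : (set T)^nat) :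
  (forall i, completion_decomposition (E i) (A i)) ->
  completion_decomposition (\bigcup_i E i) (\bigcup_i A i).
Proof.
move=> EA; split; first by apply: bigcupT_measurable => i; have [] := EA i.
exists (\bigcup_i sval (cid2 (EA i).2)).
  by apply: negligible_bigcup => i; case: cid2.
rewrite -bigcupU; apply: eq_bigcupr => i _.
by case: cid2.
Qed.

Let completion_measurable_bigcup (E : (set T)^nat) :
  (forall i, completion_measurable (E i)) ->
  completion_measurable (\bigcup_i E i).
Proof.
move=> /(_ _)/cid-/all_sig[A EA]; exists (\bigcup_i A i).
exact: decomposition_bigcup.
Qed.

Definition completion_display : measure_display -> measure_display.
Proof. exact. Qed.

HB.instance Definition _ := Pointed.on (completion_type mu).
HB.instance Definition _ := @isMeasurable.Build (completion_display d)
  (completion_type mu) completion_measurable completion_measurable0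
  completion_measurableC completion_measurable_bigcup.

Let completion0 : completion set0 = 0.
Proof.
rewrite -(setU0 set0) completionE ?measure0//; exact: negligible_set0.
Qed.

Let completion_ge0 E : 0 <= completion E.
Proof. exact: measure_ge0. Qed.

Let completion_semi_sigma_additive : semi_sigma_additive completion.
Proof.
move=> E mE tE _.
have /(_ _)/cid-/all_sig[A EA] : forall i, completion_measurable (E i) by [].
rewrite (completion_decompositionE (decomposition_bigcup EA)).
under eq_fun do under eq_bigr do rewrite (completion_decompositionE (EA _)).
apply: measure_semi_sigma_additive.
- by move=> i; have [] := EA i.
- apply/trivIsetP => i j _ _ ij; apply/seteqP; split => // x [Aix Ajx].
  move/trivIsetP : tE => /(_ i j I I ij) <-.
  have [_ [Ni _ ->]] := EA i; have [_ [Nj _ ->]] := EA j.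
  by split; left.
- by apply: bigcupT_measurable => i; have [] := EA i.
Qed.

HB.instance Definition _ := isMeasure.Build _ _ _ completion
  completion0 completion_ge0 completion_semi_sigma_additive.

End completion.
Arguments completion {d T R} mu E.

Section radon.
Context (R : realType) (X : normedModType R) (M : set (set X)).
Local Open Scope ereal_scope.

(* [mu] lives on [<<s M>>], which is [M] itself as [M] is a sigma-algebra. *)
Definition radon_measure (mu : {measure set (g_sigma_algebraType M) -> \bar R})
    : Prop :=
  [/\ sigma_algebra setT M,
      <<s (@open X) >> `<=` M,
      forall K : set X, compact K -> mu K < +oo,
      forall E : set X, M E ->
        mu E = ereal_sup [set mu K | K in [set K | K `<=` E /\ compact K]]
    & forall E : set X, M E ->
        mu E = ereal_inf [set mu G | G in [set G | E `<=` G /\ open G]]].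

End radon.

Section morse.
Context (R : realType) (X : normedModType R).
Implicit Types (a : X) (r lambda : R) (A S : set X) (delta : X -> R).

Definition cball a r : set X := closed_ball_ (fun x : X => `|x|) a r.

Definition starlike A S : Prop :=
  forall y x, A y -> S x ->
    [set t *: y + (1 - t) *: x | t in `[0, 1]] `<=` S.

Definition morse_radius lambda a S r : Prop :=
  [/\ 0 < r, cball a r `<=` S, S `<=` cball a (lambda * r)
    & starlike (cball a r) S].

Definition morse_set lambda a S : Prop := exists r, morse_radius lambda a S r.

(* Since a set may be Morse for several radii, a set is fine when one of these
   radii is small enough. *)
Definition delta_fine lambda delta a S : Prop :=
  exists2 r, morse_radius lambda a S r & lambda * r <= delta a.

(* Only the values of [delta] on the set of tags [Omega] matter. *)
Definition gauge (Omega : set X) delta : Prop :=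
  (forall a, Omega a -> 0 < delta a) /\
  exists b, forall a, Omega a -> delta a <= b.

Definition diameter S : \bar R :=
  ereal_sup [set (`|p.1 - p.2|)%:E | p in S `*` S].

(* Collections of Morse sets are sets of pairs (tag, set), as the tag of a
   Morse set is not determined by the set. *)
Definition morse_cover lambda (Omega : set X) (C : set (X * set X)) : Prop :=
  [/\ forall a S, C (a, S) -> Omega a /\ morse_set lambda a S,
      forall a, Omega a -> exists S, C (a, S)
    & exists b : R, forall a S, C (a, S) -> (diameter S <= b%:E)%E].

Definition fine_cover lambda (Omega : set X) (C : set (X * set X)) : Prop :=
  forall a, Omega a -> forall e : R, 0 < e ->
    exists r S, [/\ r < e, C (a, S) & morse_radius lambda a S r].

(* Index sets of finite (possibly empty) and of infinite sequences. *)
Definition sequence_index (I : set nat) : Prop :=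
  I = setT \/ exists n, I = `I_n.

Definition disjoint_fine_sequence lambda (C : set (X * set X)) delta
    (I : set nat) (s : nat -> X * set X) : Prop :=
  [/\ sequence_index I,
      forall n, I n -> C (s n),
      trivIset I (fun n => (s n).2)
    & forall n, I n -> delta_fine lambda delta (s n).1 (s n).2].

End morse.

Section ae_cover.
Context (R : realType) (X : normedModType R) (M : set (set X)).
Variable mu : {measure set (g_sigma_algebraType M) -> \bar R}.
Implicit Types (lambda : R) (Omega : set X) (C : set (X * set X)).

Definition ae_morse_cover lambda Omega C : Prop :=
  [/\ morse_cover lambda Omega C,
      fine_cover lambda Omega C,
      forall a S, C (a, S) -> measurable (S : set (completion_type mu))
    & forall (eps : R) (delta : X -> R), 0 < eps -> gauge Omega delta ->
        exists (I : set nat) (s : nat -> X * set X),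
          [/\ disjoint_fine_sequence lambda C delta I s,
              completion mu (Omega `\` \bigcup_(n in I) (s n).2) = 0%E
            & (completion mu (\bigcup_(n in I) (s n).2 `\` Omega)
                < eps%:E)%E]].

Definition riemann_condition lambda Omega C (f : X -> R) (F : R) : Prop :=
  forall eps : R, 0 < eps ->
    exists2 delta : X -> R, forall a, Omega a -> 0 < delta a <= 1 &
      forall (I : set nat) (s : nat -> X * set X),
        disjoint_fine_sequence lambda C delta I s ->
        completion mu (Omega `\` \bigcup_(n in I) (s n).2) = 0%E ->
        (`| \sum_(n <oo | n \in I) (f (s n).1)%:E * completion mu (s n).2
            - F%:E | < eps%:E)%E.

End ae_cover.

(* Main.v *)
Require Import Defs.
From mathcomp Require Import all_boot all_order all_algebra.
From mathcomp Require Import all_classical all_reals all_analysis.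
From mathcomp Require Import measurable_realfun lra.

Set Implicit Arguments.
Unset Strict Implicit.
Unset Printing Implicit Defensive.

Import Order.TTheory GRing.Theory Num.Theory.
Import numFieldNormedType.Exports.
Local Open Scope classical_set_scope.
Local Open Scope ring_scope.

(* Multiplicative level sets of [f] and the regularity of [mu] provide, up to
   [eps] in integral, a majorant [g] (a countable sum of multiples of
   indicators of open sets) and a minorant [h] (a finite sum of multiples of
   indicators of disjoint compact sets) such that [h y <= f x <= g y] for all
   [y] close to [x \in Omega]. A gauge witnessing this closeness squeezes every
   Riemann sum over an a.e. covering disjoint fine sequence between the integral
   of [h] over [Omega] and the integral of [g] over the space. The minorant
   exists even if the integral of [f] is infinite, in which case it makes the
   Riemann sums arbitrarily large. Conversely, an a.e. cover contains a sequence
   that is fine for two given gauges, so that two limits of Riemann sums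
   agree. *)

Section measure_lemmas.
Context d (T : measurableType d) (R : realType).
Variable nu : {measure set T -> \bar R}.
Local Open Scope ereal_scope.

(** * Integrals over a disjoint union compared with series of constants times measures *)

Section series.
Context (I : set nat) (S : nat -> set T) (c : nat -> R) (g : T -> \bar R).
Hypotheses (mS : forall n, I n -> measurable (S n)) (tS : trivIset I S).
Hypotheses (mg : measurable_fun (\bigcup_(n in I) S n) g).
Hypotheses (g0 : forall n x, I n -> S n x -> 0 <= g x).
Hypotheses (c0 : forall n, I n -> (0 <= c n)%R).

Let mgS n : I n -> measurable_fun (S n) g.
Proof.
move=> In; apply: measurable_funS mg; last exact: bigcup_sup.
exact: bigcup_measurable.
Qed.

Lemma ge0_integral_bigcup_cond :
  \int[nu]_(x in \bigcup_(n in I) S n) g x =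
  \sum_(n <oo | n \in I) \int[nu]_(x in S n) g x.
Proof.
have := mg; rewrite bigcup_mkcond => mg'.
rewrite ge0_integral_bigcup//; first last.
- by move: tS => /trivIset_mkcond.
- by rewrite -bigcup_mkcond => x [n In]; exact: g0.
- by move=> k; case: ifPn => // /set_mem/mS.
rewrite [RHS]eseries_mkcond; apply: eq_eseriesr => n _.
by case: ifP => // _; rewrite integral_set0.
Qed.

Lemma nneseries_le_integral :
  (forall n x, I n -> S n x -> (c n)%:E <= g x) ->
  \sum_(n <oo | n \in I) (c n)%:E * nu (S n) <=
  \int[nu]_(x in \bigcup_(n in I) S n) g x.
Proof.
move=> cg; rewrite ge0_integral_bigcup_cond.
apply: lee_nneseries => [n _|n] /set_mem In.
  by rewrite mule_ge0// lee_fin c0.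
rewrite -integral_cst; last exact: mS.
apply: ge0_le_integral => //.
- exact: mS.
- by move=> x _; rewrite lee_fin c0.
- exact: mgS.
- by move=> x Sx; exact: cg Sx.
Qed.

Lemma integral_le_nneseries :
  (forall n x, I n -> S n x -> g x <= (c n)%:E) ->
  \int[nu]_(x in \bigcup_(n in I) S n) g x <=
  \sum_(n <oo | n \in I) (c n)%:E * nu (S n).
Proof.
move=> gc; rewrite ge0_integral_bigcup_cond.
apply: lee_nneseries => [n _|n] /set_mem In.
  by apply: integral_ge0 => x; exact: g0.
rewrite -integral_cst; last exact: mS.
apply: ge0_le_integral => //.
- exact: mS.
- by move=> x; exact: g0.
- exact: mgS.
- by move=> x Sx; exact: gc Sx.
Qed.

End series.

(** * Approximation of a nonnegative function by multiplicative level sets *)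

Section levels.
Context (D : set T) (f : T -> R) (q : R).
Hypotheses (mD : measurable D) (mf : measurable_fun D f).
Hypotheses (f0 : forall x, D x -> (0 <= f x)%R).

(** Where [f x > 0], some rational lies strictly between [f x] and [q * f x], so the countably many
    sets on which a given positive rational lies in this interval cover the positivity set; removing
    earlier sets makes them disjoint. A multiplicative error is used because it costs only a factor
    [q] on the integral, even when [D] has infinite measure. *)
Lemma multiplicative_levels : (1 < q)%R ->
  exists (c : nat -> R) (E : nat -> set T),
    [/\ forall k, (0 < c k)%R,
        forall k, measurable (E k),
        trivIset setT E,
        D `&` [set x | (0 < f x)%R] = \bigcup_k E k
      & forall k x, E k x -> (f x <= c k <= q * f x)%R].
Proof.
move=> q1; have q0 : (0 < q)%R by rewrite (lt_trans _ q1).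
(* Integers that encode no positive rational get the level [1], which keeps every [c k] positive;
   repeated levels are harmless since [seqDU] makes the sets disjoint. *)
pose c k : R := if @unpickle rat k is Some r then
  if (0 < r)%R then ratr r else 1%R else 1%R.
have c0 k : (0 < c k)%R.
  by rewrite /c; case: unpickle => // r; case: ifPn => // r0; rewrite ltr0q.
pose A k := D `&` (f @^-1` [set` `[q^-1 * c k, c k]%R]).
have mA k : measurable (A k) by exact: mf.
have AE k x : A k x -> (f x <= c k <= q * f x)%R.
  move=> [_] /=; rewrite in_itv/= => /andP[cf ->] /=.
  by rewrite -ler_pdivrMl.
exists c, (seqDU A); split => //.
- move=> k; rewrite /seqDU; apply: measurableD => //.
  exact: bigsetU_measurable.
- rewrite -seqDU_bigcup_eq; apply/seteqP; split => x /=; last first.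
    move=> [k _ Akx]; split; first by case: Akx.
    move: (AE _ _ Akx) => /andP[_] /(lt_le_trans (c0 k)).
    by rewrite pmulr_rgt0.
  move=> [Dx fx0]; have : (f x < q * f x)%R by rewrite ltr_pMl.
  move=> /rat_in_itvoo[r]; rewrite in_itv/= => /andP[fr rq].
  have r0 : (0 < r)%R by rewrite -(ltr0q R) (lt_trans fx0).
  exists (pickle r) => //; split => //=.
  rewrite /c pickleK r0 in_itv/= (ltW fr) andbT.
  by rewrite ler_pdivrMl// ltW.
- by move=> k x [Akx _]; exact: AE.
Qed.

Lemma integral_gt0_part :
  \int[nu]_(x in D) (f x)%:E =
  \int[nu]_(x in D `&` [set x | (0 < f x)%R]) (f x)%:E.
Proof.
rewrite integral_mkcond [RHS]integral_mkcond.
apply: eq_integral => x _; rewrite !patchE in_setI.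
case: ifPn => //= /set_mem Dx; case: ifPn => //.
rewrite notin_setE/= => /negP; rewrite -leNgt => fx.
by congr EFin; apply/eqP; rewrite eq_le fx f0.
Qed.

Context (c : nat -> R) (E : nat -> set T).
Hypotheses (c0 : forall k, (0 < c k)%R) (mE : forall k, measurable (E k)).
Hypotheses (tE : trivIset setT E).
Hypotheses (DE : D `&` [set x | (0 < f x)%R] = \bigcup_k E k).
Hypotheses (Ef : forall k x, E k x -> (f x <= c k <= q * f x)%R).

Lemma level_sub k : E k `<=` D.
Proof.
move=> x Ekx; have : (\bigcup_k E k) x by exists k.
by rewrite -DE => -[].
Qed.

Let mfE : measurable_fun (\bigcup_k E k) f.
Proof. by apply: measurable_funS mf => // x [k _]; exact: level_sub. Qed.

Lemma integral_le_levels :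
  \int[nu]_(x in D) (f x)%:E <= \sum_(k <oo) (c k)%:E * nu (E k).
Proof.
rewrite integral_gt0_part DE.
rewrite (@eq_eseriesl _ _ (fun n => n \in setT)); last first.
  by move=> n; rewrite in_setT.
apply: integral_le_nneseries => //.
- exact/measurable_EFinP.
- by move=> n x _ /level_sub/f0; rewrite lee_fin.
- by move=> n x _ /Ef/andP[+ _]; rewrite lee_fin; exact.
Qed.

Lemma levels_le_integral : (0 <= q)%R ->
  \sum_(k <oo) (c k)%:E * nu (E k) <= q%:E * \int[nu]_(x in D) (f x)%:E.
Proof.
move=> q0; rewrite integral_gt0_part DE -ge0_integralZl_EFin//; last 3 first.
- exact: bigcupT_measurable.
- by move=> x [n _ /level_sub/f0]; rewrite lee_fin.
- exact/measurable_EFinP.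
rewrite (@eq_eseriesl _ _ (fun n => n \in setT)); last first.
  by move=> n; rewrite in_setT.
apply: nneseries_le_integral => //.
- by apply: measurable_funeM; exact/measurable_EFinP.
- move=> n x _ /level_sub/f0 fx.
  by rewrite mule_ge0// lee_fin.
- by move=> n _; exact: ltW.
- by move=> n x _ /Ef/andP[_]; rewrite -EFinM lee_fin.
Qed.

End levels.

End measure_lemmas.

(** Used to choose the ratio [q] of the level sets so close to [1] that a strict inequality survives
    the factor lost. *)
Lemma lt_ereal_scale (R : realType) (L : R) (v : \bar R) :
  (L%:E < v)%E -> exists2 q : R, 1 < q & ((q * L)%:E < v)%E.
Proof.
case: v => [v| |//]; last by exists 2; rewrite ?ltr1n ?ltry.
(* This makes [t * L] less than [v - L]; the [+ 1] keeps the denominator positive when [L = 0]. *)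
rewrite lte_fin => Lv; set t := (v - L) / (2 * (`|L| + 1)).
have p0 : 0 < 2 * (`|L| + 1) by have := normr_ge0 L; lra.
have t0 : 0 < t by rewrite divr_gt0//; lra.
exists (1 + t); first by lra.
rewrite lte_fin.
have tE : t * (2 * (`|L| + 1)) = v - L by rewrite /t divfK// gt_eqF.
have : t * L <= t * `|L| by rewrite ler_pM2l// ler_norm.
have := normr_ge0 L; nra.
Qed.

Lemma lte_add_split (R : realType) (L : R) (a b : \bar R) :
  (0 <= a -> 0 <= b -> L%:E < a + b ->
  exists L1 L2, [/\ L1%:E < a, L2%:E < b & L%:E <= L1%:E + L2%:E])%E.
Proof.
(* [-1] lies strictly below any nonnegative summand, so an infinite summand can take the remaining
   [L + 1]. *)
have N1 : ((-1)%:E < 0 :> \bar R)%E by rewrite lte_fin; lra.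
have split_add (M : R) : (L%:E <= (-1)%:E + (L + 1)%:E :> \bar R)%E.
  by rewrite lee_fin; lra.
case: a b => [a| |//] [b| |//] a0 b0.
- rewrite lte_fin => Lab; exists (a - (a + b - L) / 2), (b - (a + b - L) / 2).
  by clear -Lab; split; rewrite ?lte_fin ?lee_fin; lra.
- move=> _; exists (-1), (L + 1).
  by split; [exact: lt_le_trans a0|exact: ltry|exact: split_add].
- move=> _; exists (L + 1), (-1); rewrite [X in (_ <= X)%E]addeC.
  by split; [exact: ltry|exact: lt_le_trans b0|exact: split_add].
- move=> _; exists (L + 1), (-1); rewrite [X in (_ <= X)%E]addeC.
  by split; [exact: ltry|exact: ltry|exact: split_add].
Qed.

(** * Regularity of the completed Radon measure and semicontinuous approximation *)

Section radon.
Context (R : realType) (X : normedModType R) (M : set (set X)).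
Variable mu : {measure set (g_sigma_algebraType M) -> \bar R}.
Hypothesis mu_radon : radon_measure mu.
Local Notation nu := (completion mu).
Local Notation XM := (completion_type mu).
Local Open Scope ereal_scope.

Lemma radon_measurable (A : set X) :
  measurable (A : set (g_sigma_algebraType M)) -> M A.
Proof.
by case: mu_radon => sM _ _ _ _; rewrite /measurable/= sigma_algebra_id.
Qed.

Lemma radon_open_measurable (G : set X) :
  open G -> measurable (G : set (g_sigma_algebraType M)).
Proof.
case: mu_radon => _ BM _ _ _ oG; apply: sub_sigma_algebra; apply: BM.
exact: sub_sigma_algebra.
Qed.

Lemma radon_compact_measurable (K : set X) :
  compact K -> measurable (K : set (g_sigma_algebraType M)).
Proof.
move=> /(compact_closed (@norm_hausdorff _ _)) cK; rewrite -(setCK K).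
by apply: measurableC; apply: radon_open_measurable; exact: closed_openC.
Qed.

Lemma completion_id (A : set X) :
  measurable (A : set (g_sigma_algebraType M)) -> nu A = mu A.
Proof.
by move=> mA; rewrite -[in LHS](setU0 A) completionE//; exact: negligible_set0.
Qed.

(** Enlarging the negligible part of [E] to a measurable null set [Z] gives a superset of [E] in [M]
    with the same measure, to which outer regularity of [mu] applies. *)
Lemma completion_outer_regular (E : set X) (v : \bar R) :
  measurable (E : set XM) -> nu E < v ->
  exists G : set X, [/\ open G, E `<=` G & nu G < v].
Proof.
move=> [A [mA [N [Z [mZ Z0 NZ]] ->]]].
rewrite completionE//; last by exists Z.
have mAZ : measurable (A `|` Z) by exact: measurableU.
rewrite -(measureU0 mA mZ Z0) => AZv.
case: mu_radon => _ _ _ _ /(_ _ (radon_measurable mAZ)) outer.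
move: AZv; rewrite outer => /ereal_inf_lt[_ [G [AZG oG] <-] Gv].
exists G; rewrite completion_id; last exact: radon_open_measurable.
by split => //; apply: subset_trans AZG; exact: setUS.
Qed.

(** Here the negligible part is dropped: compact subsets of the measurable part [A] suffice. *)
Lemma completion_inner_regular (E : set X) (v : \bar R) :
  measurable (E : set XM) -> v < nu E ->
  exists K : set X, [/\ compact K, K `<=` E & v < nu K].
Proof.
move=> [A [mA [N N0 ->]]]; rewrite completionE// => vA.
case: mu_radon => _ _ _ /(_ _ (radon_measurable mA)) inner _.
move: vA; rewrite inner => /ereal_sup_gt[_ [K [KA cK] <-] vK].
exists K; rewrite completion_id; last exact: radon_compact_measurable.
by split => // x /KA; left.
Qed.

Lemma completion_open_measurable (G : set X) :
  open G -> measurable (G : set XM).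
Proof. by move=> /radon_open_measurable; exact: sub_completion_measurable. Qed.

Lemma completion_compact_measurable (K : set X) :
  compact K -> measurable (K : set XM).
Proof. by move=> /radon_compact_measurable; exact: sub_completion_measurable. Qed.

(** Induction on [N], distributing the lower bound over the terms. A strict lower bound, rather than
    an error term, allows some [nu (E k)] to be infinite. *)
Lemma completion_sum_inner_regular (c : nat -> R) (E : nat -> set X)
    (N : nat) (L : R) :
  (forall k, (0 < c k)%R) -> (forall k, measurable (E k : set XM)) ->
  L%:E < \sum_(k < N) (c k)%:E * nu (E k) ->
  exists K : nat -> set X, [/\ forall k, compact (K k),
    forall k, K k `<=` E k & L%:E < \sum_(k < N) (c k)%:E * nu (K k)].
Proof.
move=> c0 mE; elim: N L => [|N IH] L.
  rewrite big_ord0 => L0; exists (fun=> set0); rewrite big_ord0.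
  by split => // k; [exact: compact0|exact: sub0set].
rewrite big_ord_recr/= => /lte_add_split[| |L1 [L2 [L1s L2N L12]]].
- by apply: sume_ge0 => k _; rewrite mule_ge0// lee_fin ltW.
- by rewrite mule_ge0// lee_fin ltW.
have [K [cK KE L1K]] := IH _ L1s.
have : (L2 / c N)%:E < nu (E N).
  by rewrite -(@lte_pmul2l _ (c N)%:E)// -?EFinM ?lte_fin// mulrC divfK ?gt_eqF.
move=> /(completion_inner_regular (mE N))[K' [cK' K'E L2K']].
exists (fun k => if k == N then K' else K k); split.
- by move=> k; case: ifP.
- by move=> k; case: eqP => [->|_].
- rewrite big_ord_recr/= eqxx (le_lt_trans L12)//.
  under eq_bigr do rewrite ltn_eqF//.
  apply: lteD => //.
  rewrite -(@lte_pmul2l _ (c N)%:E)// -?EFinM ?lte_fin// in L2K'.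
  by move: L2K'; rewrite mulrC divfK ?gt_eqF.
Qed.

Lemma lower_semicontinuous_majorant (Omega : set X) (f : X -> R) (F eps : R) :
  measurable (Omega : set XM) -> (forall x, Omega x -> (0 <= f x)%R) ->
  measurable_fun (Omega : set XM) f ->
  \int[nu]_(x in Omega) (f x)%:E = F%:E -> (0 < eps)%R ->
  exists g : XM -> \bar R, [/\ forall x, 0 <= g x, measurable_fun setT g,
    forall x, Omega x -> \forall y \near (x : X), (f x)%:E <= g y
    & \int[nu]_x g x < (F + eps)%:E].
Proof.
move=> mO f0 mf intf e0.
(* Half of [eps] pays for the level sets; the other half, split into a geometric series, pays for
   enlarging them to open sets. *)
have [q q1 qF] : exists2 q : R, (1 < q)%R & (q * F)%:E < (F + eps / 2)%:E.
  by apply: lt_ereal_scale; rewrite lte_fin; lra.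
have q0 : (0 < q)%R by lra.
have [c [E [c0 mE tE EO Ef]]] := multiplicative_levels mO mf q1.
have cE_ge0 k : 0 <= (c k)%:E * nu (E k) by rewrite mule_ge0// lee_fin ltW.
have sumE : \sum_(k <oo) (c k)%:E * nu (E k) <= (q * F)%:E.
  by rewrite EFinM -intf; exact: (levels_le_integral _ mO mf f0 c0 mE tE EO Ef (ltW q0)).
have /choice[G GE] : forall k, exists G : set X, [/\ open G, E k `<=` G &
    (c k)%:E * nu G <= (c k)%:E * nu (E k) + (eps / 2 / (2 ^ k.+1)%:R)%:E].
  move=> k; set t := (eps / 2 / (2 ^ k.+1)%:R)%R.
  have t0 : (0 < t)%R by rewrite !divr_gt0// ltr0n expn_gt0.
  (* Finiteness makes [nu (E k) + t / c k] strictly larger than [nu (E k)], as outer regularity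
     requires; it holds since [c k > 0] and the whole series is at most [q * F]. *)
  have Ek_fin : nu (E k) \is a fin_num.
    rewrite ge0_fin_numE// ltNge leye_eq; apply/negP => /eqP Ek.
    have : (c k)%:E * nu (E k) <= (q * F)%:E.
      apply: le_trans sumE; apply: le_trans (nneseries_lim_ge k.+1 _) => //.
      by rewrite big_nat_recr//= leeDr// sume_ge0.
    by rewrite Ek gt0_muley ?lte_fin.
  have : nu (E k) < nu (E k) + (t / c k)%:E.
    by rewrite lteDl// lte_fin divr_gt0.
  move=> /(completion_outer_regular (mE k))[G [oG EG Gv]].
  exists G; split => //.
  rewrite (_ : t%:E = (c k)%:E * (t / c k)%:E); last first.
    by rewrite -EFinM mulrC divfK// gt_eqF.
  rewrite -ge0_muleDr//; last by rewrite lee_fin divr_ge0 ?ltW.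
  by rewrite lee_pmul2l ?lte_fin// ltW.
exists (fun x => \sum_(k <oo) ((c k)%:E * (\1_(G k) x)%:E)).
have h0 k x : 0 <= (c k)%:E * (\1_(G k) x)%:E.
  by rewrite mule_ge0// lee_fin// ltW.
have mG k : measurable (G k : set XM).
  by apply: completion_open_measurable; case: (GE k).
have mh k : measurable_fun (setT : set XM) (fun x => (c k)%:E * (\1_(G k) x)%:E).
  apply: measurable_funeM; apply/measurable_EFinP; exact: measurable_indic.
split.
- by move=> x; apply: nneseries_ge0 => k _ _.
- exact: (ge0_emeasurable_sum (P := xpredT)).
(* Where [f x = 0], nonnegativity of [g] is enough; otherwise [x] lies in some [E k], and the term
   of index [k] alone dominates [f x] on the neighbourhood [G k]. *)
- move=> x Ox; have [fx0|fx0] := ltP 0%R (f x); last first.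
    by near=> y; rewrite (@le_trans _ _ 0)// ?lee_fin//; apply: nneseries_ge0.
  have [k _ Ekx] : (\bigcup_k E k) x by rewrite -EO.
  have [oG EG _] := GE k.
  have : \forall y \near x, G k y by apply: open_nbhs_nbhs; split => //; exact: EG.
  apply: filterS => y Gy.
  have /andP[fc _] := Ef _ _ Ekx.
  apply: (@le_trans _ _ ((c k)%:E * (\1_(G k) y)%:E)).
    by rewrite indicE mem_set// mule1 lee_fin.
  apply: le_trans (nneseries_lim_ge k.+1 _) => //.
  by rewrite big_nat_recr//= leeDr// sume_ge0.
- rewrite integral_nneseries//.
  apply: (@le_lt_trans _ _ (\sum_(k <oo) ((c k)%:E * nu (E k) +
      (eps / 2 / (2 ^ k.+1)%:R)%:E))).
    apply: lee_nneseries => [k _ _|k _]; first exact: integral_ge0.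
    rewrite ge0_integralZl_EFin//; last 2 first.
    - by apply/measurable_EFinP; exact: measurable_indic.
    - exact: ltW.
    by rewrite integral_indic// setIT; case: (GE k).
  have e2 : (0 <= eps / 2)%R by lra.
  apply: le_lt_trans (epsilon_trick xpredT cE_ge0 e2) _.
  have -> : (F + eps = F + eps / 2 + eps / 2)%R by lra.
  by rewrite EFinD lteD2rE//; exact: le_lt_trans qF.
Unshelve. all: by end_near.
Qed.

Lemma upper_semicontinuous_minorant (Omega : set X) (f : X -> R) (L : R) :
  measurable (Omega : set XM) -> (forall x, Omega x -> (0 <= f x)%R) ->
  measurable_fun (Omega : set XM) f ->
  L%:E < \int[nu]_(x in Omega) (f x)%:E ->
  exists h : XM -> \bar R, [/\ forall x, 0 <= h x, measurable_fun setT h,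
    forall x, Omega x -> \forall y \near (x : X), h y <= (f x)%:E
    & L%:E < \int[nu]_(x in Omega) h x].
Proof.
move=> mO f0 mf Lf; have [q q1 qL] := lt_ereal_scale Lf.
have q0 : (0 < q)%R by lra.
have [c [E [c0 mE tE EO Ef]]] := multiplicative_levels mO mf q1.
have cE_ge0 k : 0 <= (c k)%:E * nu (E k) by rewrite mule_ge0// lee_fin ltW.
(* A finite partial sum already exceeds [q * L], even if the integral is infinite; dividing the
   levels by [q] then leaves the bound [L] and puts each level below [f] on its set. *)
have [N LN] : exists N, (q * L)%:E < \sum_(k < N) (c k)%:E * nu (E k).
  apply: contrapT => /forallNP LN; move: qL; apply/negP; rewrite -leNgt.
  apply: le_trans (integral_le_levels _ mO mf f0 mE tE EO Ef) _.
  apply: lime_le; first exact: is_cvg_nneseries.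
  by near=> n; rewrite big_mkord leNgt; apply/negP; exact: LN.
have [K [cK KE LK]] := completion_sum_inner_regular c0 mE LN.
have b0 k : (0 < c k / q)%R by rewrite divr_gt0.
have KO k : K k `<=` Omega.
  by apply: subset_trans (KE k) _; exact: (level_sub EO).
pose h k (x : XM) := (c k / q)%:E * (\1_(K k) x)%:E.
have mK k : measurable (K k : set XM) by exact: completion_compact_measurable.
have h0 k x : 0 <= h k x by rewrite mule_ge0// lee_fin// ltW.
have mh k : measurable_fun (setT : set XM) (h k).
  by apply: measurable_funeM; apply/measurable_EFinP; exact: measurable_indic.
exists (fun x => \sum_(k < N) h k x); split.
- by move=> x; exact: sume_ge0.
- exact: emeasurable_sum.
- move=> x Ox.
  (* Each compact set missing [x] is closed, so its complement is a neighbourhood of [x]; having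
     only finitely many of them allows these neighbourhoods to be intersected. *)
  have : \forall y \near x, forall k : 'I_N, K k y -> K k x.
    apply: filter_forall => k; have [Kx|Kx] := pselect (K k x).
      by near=> y.
    have : \forall y \near x, (~` K k) y.
      apply: open_nbhs_nbhs; split => //; apply: closed_openC.
      exact: compact_closed (@norm_hausdorff _ _) (cK k).
    by apply: filterS => y /= Ky /Ky.
  apply: filterS => y Ky.
  have [[k Kky]|noK] := pselect (exists k : 'I_N, K k y); last first.
    rewrite big1 ?lee_fin ?f0// => k _.
    by rewrite /h indicE memNset ?mule0// => Kky; apply: noK; exists k.
  (* By disjointness of the [E j], only the term of index [k] is nonzero at [y], and [x] lies in the
     same [K k]. *)
  rewrite (bigD1 k)//= big1 ?adde0 => [|j jk].
    rewrite /h indicE mem_set// mule1 lee_fin ler_pdivrMr// mulrC.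
    by have /andP[] := Ef _ _ (KE _ _ (Ky _ Kky)).
  rewrite /h indicE memNset ?mule0// => Kjy.
  have : (E j `&` E k) y by split; exact: KE.
  by move=> /(ex_intro _ y)/tE => /(_ I I)/ord_inj/eqP; rewrite (negbTE jk).
- rewrite ge0_integral_sum//; last by move=> k; exact: measurable_funTS.
  have -> : \sum_(k < N) \int[nu]_(x in Omega) h k x =
      (q^-1)%:E * \sum_(k < N) (c k)%:E * nu (K k).
    rewrite ge0_sume_distrr; last first.
      by move=> k _; rewrite mule_ge0// lee_fin ltW.
    apply: eq_bigr => k _; rewrite muleA -EFinM [(q^-1 * _)%R]mulrC.
    rewrite ge0_integralZl_EFin//; last 2 first.
    - by apply/measurable_EFinP; exact: measurable_indic.
    - exact: ltW.
    by rewrite integral_indic// setIidl.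
  rewrite -(@lte_pmul2l _ q%:E)// muleA -!EFinM divff ?gt_eqF// mul1e.
  by rewrite EFinM.
Unshelve. all: by end_near.
Qed.

(** * Gauges, fine sequences and bounds on Riemann sums *)

Section riemann_sums.
Context (Omega : set X) (lambda : R) (C : set (X * set X)) (f : X -> R).
Hypothesis C_cover : ae_morse_cover mu lambda Omega C.
Hypothesis f0 : forall x, Omega x -> (0 <= f x)%R.
Hypothesis mO : measurable (Omega : set XM).

Lemma near_gauge (P : X -> X -> Prop) :
  (forall x, Omega x -> \forall y \near x, P x y) ->
  exists2 delta : X -> R, forall x, Omega x -> (0 < delta x <= 1)%R &
    forall x y, Omega x -> (`|x - y| <= delta x)%R -> P x y.
Proof.
move=> nP.
have /choice[delta dP] : forall x, exists e : R, Omega x ->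
    (0 < e <= 1)%R /\ forall y, (`|x - y| <= e)%R -> P x y.
  move=> x; have [Ox|nOx] := pselect (Omega x); last by exists 0%R.
  have /nbhs_ballP[e /= e0 eP] := nP x Ox.
  (* Halving [e] turns the open ball into a closed condition [<=]; the minimum enforces the bound
     [1] on gauges. *)
  exists (Num.min 1 (e / 2))%R => _; split.
    by rewrite lt_min ltr01 divr_gt0//= ge_min lexx.
  move=> y; rewrite le_min => /andP[_ xy]; apply: eP.
  by rewrite -ball_normE /= (le_lt_trans xy)// ltr_pdivrMr// ltr_pMr// ltr1n.
exists delta => [x /dP[]//|x y Ox]; exact: (dP x Ox).2.
Qed.

Lemma delta_fineS (delta delta' : X -> R) a S :
  (delta a <= delta' a)%R ->
  delta_fine lambda delta a S -> delta_fine lambda delta' a S.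
Proof. by move=> dd [r rS rd]; exists r => //; exact: le_trans dd. Qed.

(** A sequence fine for the pointwise minimum of the two gauges is fine for both. *)
Lemma common_fine_sequence (delta1 delta2 : X -> R) :
  (forall x, Omega x -> (0 < delta1 x <= 1)%R) ->
  (forall x, Omega x -> (0 < delta2 x <= 1)%R) ->
  exists (I : set nat) (s : nat -> X * set X),
    [/\ disjoint_fine_sequence lambda C delta1 I s,
        disjoint_fine_sequence lambda C delta2 I s
      & nu (Omega `\` \bigcup_(n in I) (s n).2) = 0].
Proof.
move=> d1 d2; pose delta x := Num.min (delta1 x) (delta2 x).
have gauge_delta : gauge Omega delta.
  split => [a Oa|]; last first.
    by exists 1%R => a /d1/andP[_ da]; rewrite ge_min da.
  by have /andP[? _] := d1 a Oa; have /andP[? _] := d2 a Oa; rewrite lt_min; apply/andP.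
have [_ _ _ /(_ 1%R delta ltr01 gauge_delta)] := C_cover.
move=> [I [s [[Iseq sC tI sfine] Os _]]].
exists I, s; split => //; split => // n In;
  by apply: delta_fineS (sfine n In); rewrite ge_min lexx ?orbT.
Qed.

Section sums.
Context (delta : X -> R) (I : set nat) (s : nat -> X * set X).
Hypothesis s_fine : disjoint_fine_sequence lambda C delta I s.

Let sC n : I n -> C (s n). Proof. by case: s_fine => _ + _ _; exact. Qed.

Lemma fine_sequence_tag n : I n -> Omega (s n).1.
Proof.
have [[CO _ _] _ _ _] := C_cover.
by move=> /sC; rewrite [s n]surjective_pairing => /CO[].
Qed.

Lemma fine_sequence_measurable n : I n -> measurable ((s n).2 : set XM).
Proof.
have [_ _ mC _] := C_cover.
by move=> /sC; rewrite [s n]surjective_pairing => /mC.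
Qed.

(** Follows from the outer ball of radius [lambda * r]; it carries a comparison with the value of
    [f] at the tag over to the whole set. *)
Lemma fine_sequence_sub n x : I n -> (s n).2 x ->
  (`|(s n).1 - x| <= delta (s n).1)%R.
Proof.
move=> In; case: s_fine => _ _ _ /(_ n In)[r [_ _ rS _] rd] /rS /= /le_trans.
exact.
Qed.

Let tI : trivIset I (fun n => (s n).2). Proof. by case: s_fine. Qed.

(** The sets may protrude from [Omega], hence an upper bound by the integral over the whole
    space. *)
Lemma riemann_sum_le (g : XM -> \bar R) :
  (forall x, 0 <= g x) -> measurable_fun setT g ->
  (forall x y, Omega x -> (`|x - y| <= delta x)%R -> (f x)%:E <= g y) ->
  \sum_(n <oo | n \in I) (f (s n).1)%:E * nu (s n).2 <= \int[nu]_x g x.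
Proof.
move=> g0 mg fg; apply: (@le_trans _ _ (\int[nu]_(x in \bigcup_(n in I) (s n).2) g x)).
  apply: (nneseries_le_integral (T := XM) _ (S := fun n => (s n).2)
    (c := fun n => f (s n).1)) => //.
  - exact: fine_sequence_measurable.
  - exact: measurable_funTS.
  - by move=> n /fine_sequence_tag/f0.
  - move=> n x In Sx; apply: fg; first exact: fine_sequence_tag.
    exact: fine_sequence_sub.
apply: ge0_subset_integral => //.
by apply: bigcup_measurable => n; exact: fine_sequence_measurable.
Qed.

Lemma riemann_sum_ge (h : XM -> \bar R) :
  (forall x, 0 <= h x) -> measurable_fun setT h ->
  (forall x y, Omega x -> (`|x - y| <= delta x)%R -> h y <= (f x)%:E) ->
  nu (Omega `\` \bigcup_(n in I) (s n).2) = 0 ->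
  \int[nu]_(x in Omega) h x <=
  \sum_(n <oo | n \in I) (f (s n).1)%:E * nu (s n).2.
Proof.
move=> h0 mh hf Os0.
have mS : measurable (\bigcup_(n in I) (s n).2 : set XM).
  by apply: bigcup_measurable => n; exact: fine_sequence_measurable.
apply: (@le_trans _ _ (\int[nu]_(x in \bigcup_(n in I) (s n).2) h x)).
  (* The part of [Omega] left uncovered is null, so it can be removed from the domain of
     integration. *)
  rewrite (ge0_negligible_integral (measurableD mO mS) mO)//; last first.
    exact: measurable_funTS.
  rewrite setDD; apply: ge0_subset_integral => //.
  - exact: measurableI.
  - exact: measurable_funTS.
apply: (integral_le_nneseries (T := XM) _ (S := fun n => (s n).2)
  (c := fun n => f (s n).1)) => //.
- exact: fine_sequence_measurable.
- exact: measurable_funTS.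
- move=> n x In Sx; apply: hf; first exact: fine_sequence_tag.
  exact: fine_sequence_sub.
Qed.

End sums.

Lemma riemann_condition_integral (F : R) :
  measurable_fun (Omega : set XM) f ->
  \int[nu]_(x in Omega) (f x)%:E = F%:E ->
  riemann_condition mu lambda Omega C f F.
Proof.
move=> mf intf eps e0.
have [g [g0 mg fg gF]] := lower_semicontinuous_majorant mO f0 mf intf e0.
have [h [h0 mh hf hF]] : exists h : XM -> \bar R,
    [/\ forall x, 0 <= h x, measurable_fun setT h,
      forall x, Omega x -> \forall y \near (x : X), h y <= (f x)%:E
      & (F - eps)%:E < \int[nu]_(x in Omega) h x].
  by apply: upper_semicontinuous_minorant; rewrite // intf lte_fin; lra.
have [x Ox|delta d01 dP] := near_gauge
    (P := fun x y => h y <= (f x)%:E /\ (f x)%:E <= g y).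
  by apply: filterI; [exact: hf|exact: fg].
exists delta => // I s s_fine Os.
have : \sum_(n <oo | n \in I) (f (s n).1)%:E * nu (s n).2 < (F + eps)%:E.
  apply: le_lt_trans gF; apply: (riemann_sum_le s_fine) => //.
  by move=> x y Ox xy; case: (dP x y Ox xy).
have : (F - eps)%:E < \sum_(n <oo | n \in I) (f (s n).1)%:E * nu (s n).2.
  apply: (lt_le_trans hF); apply: (riemann_sum_ge s_fine) => //.
  by move=> x y Ox xy; case: (dP x y Ox xy).
(* The Riemann sum lies strictly between two reals, which excludes infinite values. *)
case: (\sum_(n <oo | n \in I) _) => [r| |]//; rewrite ?lte_fin => Fr rF.
by rewrite ltr_distl Fr.
Qed.

Lemma integral_riemann_condition (F : R) :
  measurable_fun (Omega : set XM) f ->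
  riemann_condition mu lambda Omega C f F ->
  \int[nu]_(x in Omega) (f x)%:E = F%:E.
Proof.
move=> mf RF.
have : 0 <= \int[nu]_(x in Omega) (f x)%:E.
  by apply: integral_ge0 => x /f0; rewrite lee_fin.
case intf : (\int[nu]_(x in Omega) (f x)%:E) => [r| |]// _.
(* For a finite integral [r], the condition holds for both [r] and [F]; a sequence fine for both
   gauges gives one sum within [e / 2] of each. *)
- have Rr := riemann_condition_integral mf intf.
  congr EFin; apply/eqP; rewrite -subr_eq0 -normr_le0; apply/ler_addgt0Pr => e e0.
  have e2 : (0 < e / 2)%R by rewrite divr_gt0.
  have [d1 d101 d1P] := RF _ e2; have [d2 d201 d2P] := Rr _ e2.
  have [I [s [sd1 sd2 Os]]] := common_fine_sequence d101 d201.
  move: (d1P I s sd1 Os) (d2P I s sd2 Os).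
  case: (\sum_(n <oo | n \in I) _) => [v| |]//.
  rewrite !lte_fin add0r => vF vr.
  rewrite (splitr e) (le_trans (ler_distD v r F))// lerD ?ltW//.
  by rewrite distrC.
(* For an infinite integral, a minorant pushes the sum above [F + 1], while the gauge given by the
   condition with error [1] keeps it below. *)
- have : (F + 1)%:E < \int[nu]_(x in Omega) (f x)%:E by rewrite intf ltry.
  move=> /(upper_semicontinuous_minorant mO f0 mf)[h [h0 mh hf hF]].
  have [d1 d101 d1P] := RF _ ltr01.
  have [d2 d201 d2P] := near_gauge (P := fun x y => h y <= (f x)%:E) hf.
  have [I [s [sd1 sd2 Os]]] := common_fine_sequence d101 d201.
  have := lt_le_trans hF (riemann_sum_ge sd2 h0 mh d2P Os).
  have := d1P I s sd1 Os.
  case: (\sum_(n <oo | n \in I) _) => [v| |]//.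
  rewrite !lte_fin ltr_distl => /andP[_ vF] /(lt_trans vF).
  by rewrite ltxx.
Qed.

End riemann_sums.

End radon.

Theorem theorem12 (R : realType) (X : normedVectType R) (M : set (set X))
    (mu : {measure set (g_sigma_algebraType M) -> \bar R})
    (Omega : set X) (f : X -> R) (F : R) :
  radon_measure mu ->
  measurable (Omega : set (completion_type mu)) ->
  (forall x, Omega x -> 0 <= f x) ->
  measurable_fun (Omega : set (completion_type mu)) f ->
  ((exists2 lambda : R, 1 <= lambda &
      exists2 C : set (X * set X), ae_morse_cover mu lambda Omega C &
        riemann_condition mu lambda Omega C f F) ->
    (\int[completion mu]_(x in Omega) (f x)%:E = F%:E)%E) /\
  ((\int[completion mu]_(x in Omega) (f x)%:E = F%:E)%E ->
    forall lambda : R, 1 <= lambda ->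
    forall C : set (X * set X), ae_morse_cover mu lambda Omega C ->
      riemann_condition mu lambda Omega C f F).
Proof.
move=> mu_radon mO f0 mf; split.
- by move=> [lambda _ [C CO RF]]; exact: (integral_riemann_condition mu_radon CO).
- by move=> intf lambda _ C CO; exact: riemann_condition_integral.
Qed.
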